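(* Let $a>0$ and let $\lambda:E\to[0,\infty)$ be continuous. Suppose there exist constants $y_0\ge0$ and $\lambda_{\min}>0$ such that $\lambda(y,j)\ge\lambda_{\min}$ for all $(y,j)\in E$ with $jy\ge y_0$. Then the transition semigroup $(P(t))_{t\ge0}$ of the zig-zag process with speed $a$ and switching rate $\lambda$ is not strong Feller.
   Context: $E=\mathbb{R}\times\{-1,+1\}$ with the product topology; $B_b(E)$ and $C_b(E)$ are the bounded Borel measurable and bounded continuous functions on $E$. A semigroup $(P(t))_{t\ge0}$ is strong Feller if $P(t)\varphi\in C_b(E)$ for any $t>0$ and any $\varphi\in B_b(E)$. For $(y,j)\in E$ let $F(t;y,j)=\exp\left(-\int_0^t\lambda(y+ajs,j)\,ds\right)$, $t\ge0$. The zig-zag process $(Y(t),J(t))$ started from $(y,j)$, with law $\mathbb{P}_{y,j}$, is defined as follows: $T_0=0$, $Y(0)=y$, $J(0)=j$; for $i=1,2,\dots$, $Z_i$ is a random variable with $\mathbb{P}_{y,j}(Z_i>t\mid Z_1,\dots,Z_{i-1})=F(t;Y(T_{i-1}),J(T_{i-1}))$, $T_i=T_{i-1}+Z_i$, $J(t)=J(T_{i-1})$ for $T_{i-1}<t<T_i$, $J(T_i)=-J(T_{i-1})$, and $Y(t)=Y(T_{i-1})+J(T_{i-1})a(t-T_{i-1})$ for $T_{i-1}<t\le T_i$. Under the hypotheses, $T_k\to\infty$ almost surely, so the process is defined for all times. Its semigroup is $P(t)\varphi(y,j)=\mathbb{E}_{y,j}[\varphi(Y(t),J(t))]$. *)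

(* Defs.v *)
From HB Require Import structures.
From mathcomp Require Import all_boot all_order all_algebra.
From mathcomp Require Import all_classical all_reals all_analysis.

Set Implicit Arguments.
Unset Strict Implicit.
Unset Printing Implicit Defensive.

Import Order.TTheory GRing.Theory Num.Theory.
Import numFieldNormedType.Exports.

Local Open Scope classical_set_scope.
Local Open Scope ring_scope.

(* The two-point space {-1, +1} is encoded by [bool] (with its discrete
   topology), [true] standing for +1. The map j |-> -j is then [negb]. *)
Definition dir (R : realType) (j : bool) : R := if j then 1 else -1.
Arguments dir {R} j.

(* E = R x {-1, +1}; the product carries the product topology. *)
Definition state (R : realType) := (R * bool)%type.

(* B_b(E): measurability is with respect to the Borel sigma-algebra, i.e. the
   one generated by the open sets of E. *)
Definition bounded_borel (R : realType) (phi : state R -> R) : Prop :=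
  measurable_fun [set: g_sigma_algebraType (@open (R * bool)%type)] phi /\
  bounded_fun phi.

Definition bounded_continuous (R : realType) (phi : state R -> R) : Prop :=
  continuous (phi : (R * bool)%type -> R) /\ bounded_fun phi.

Definition strong_feller (R : realType)
    (S : R -> (state R -> R) -> (state R -> R)) : Prop :=
  forall t, 0 < t -> forall phi, bounded_borel phi ->
    bounded_continuous (S t phi).

(* [f] is a version of the conditional probability P(A | G). *)
Definition cond_probability (R : realType) (d : measure_display)
    (W : measurableType d) (P : probability W R) (G : set (set W))
    (A : set W) (f : W -> R) : Prop :=
  (forall B : set R, measurable B -> G (f @^-1` B)) /\
  (forall C, G C -> P (A `&` C) = \int[P]_(w in C) (f w)%:E)%E.

Definition survival (R : realType) (a : R) (lam : state R -> R)
    (t : R) (x : state R) : R :=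
  expR (- \int[lebesgue_measure]_(s in `[0, t])
            lam (x.1 + a * dir x.2 * s, x.2)).

(* Deterministic construction of a trajectory from its start [x] and its
   waiting times. Indices are shifted by one: [z k] is Z_(k+1). *)

Definition switch_time (R : realType) (z : nat -> R) (n : nat) : R :=
  \sum_(k < n) z k.

(* (Y(T_n), J(T_n)) *)
Fixpoint switch_state (R : realType) (a : R) (x : state R) (z : nat -> R)
    (n : nat) : state R :=
  if n is m.+1 then
    let s := switch_state a x z m in (s.1 + dir s.2 * a * z m, ~~ s.2)
  else x.

(* The number of switches in [0, t], namely the least n with t < T_(n+1). The
   value 0 is a dummy, used when the switching times stay below t. *)
Definition num_switches (R : realType) (z : nat -> R) (t : R) : nat :=
  if pselect (exists n, t < switch_time z n.+1) is left e then ex_minn e else 0.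

(* (Y(t), J(t)): on [T_n, T_(n+1)) the position moves linearly from Y(T_n) with
   velocity J(T_n) a, and the direction is J(T_n). *)
Definition zigzag_path (R : realType) (a : R) (x : state R) (z : nat -> R)
    (t : R) : state R :=
  let n := num_switches z t in
  let s := switch_state a x z n in
  (s.1 + dir s.2 * a * (t - switch_time z n), s.2).

Lemma zigzag_pathE (R : realType) (a : R) (x : state R) (z : nat -> R) n t :
  (forall k, 0 < z k) -> switch_time z n <= t < switch_time z n.+1 ->
  zigzag_path a x z t =
    ((switch_state a x z n).1 +
       dir (switch_state a x z n).2 * a * (t - switch_time z n),
     (switch_state a x z n).2).
Proof.
move=> z0 /andP[Tnt tTn]; rewrite /zigzag_path.
suff -> : num_switches z t = n by [].
have Tmono m p : (m <= p)%N -> switch_time z m <= switch_time z p.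
  move=> /subnK <-; elim: (p - m)%N => // k /le_trans; apply.
  by rewrite addSn {2}/switch_time big_ord_recr /= lerDl ltW.
rewrite /num_switches; case: pselect => [e|]; last by case; exists n.
case: ex_minnP => m tTm mmin; apply/eqP; rewrite eqn_leq mmin //=.
rewrite leqNgt; apply/negP => /Tmono Tmn.
by have := lt_le_trans tTm Tmn; rewrite ltNge Tnt.
Qed.

(* A zig-zag process with speed [a] and switching rate [lam] started from [x]:
   a probability space carrying the waiting times, which have the prescribed
   conditional laws. They are real-valued, which is no loss when
   [survival a lam t x] tends to 0 as t tends to +oo for every x. Neither their
   almost sure positivity nor the divergence of the switching times is part of
   the definition. *)
Record zigzag_process (R : realType) (a : R) (lam : state R -> R)
    (x : state R) := ZigzagProcess {
  zz_disp : measure_display ;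
  zz_space : measurableType zz_disp ;
  zz_prob : probability zz_space R ;
  zz_wait : nat -> {RV zz_prob >-> R} ;
  zz_wait_law : forall (n : nat) (t : R), 0 <= t ->
    cond_probability zz_prob
      (g_sigma_preimage (fun k : 'I_n => zz_wait k : zz_space -> R))
      [set w | t < zz_wait n w]
      (fun w => survival a lam t (switch_state a x (zz_wait ^~ w) n)) }.

Definition zz_at (R : realType) (a : R) (lam : state R -> R) (x : state R)
    (X : zigzag_process a lam x) (t : R) (w : zz_space X) : state R :=
  zigzag_path a x (fun k => zz_wait X k w) t.

(* P(t) phi (y, j) = E_(y, j)[phi (Y(t), J(t))]; expectations take values in
   the extended reals, hence [fine]. *)
Definition zigzag_semigroup (R : realType) (a : R) (lam : state R -> R)
    (X : forall x, zigzag_process a lam x)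
    (t : R) (phi : state R -> R) : state R -> R :=
  fun x => fine ('E_(zz_prob (X x)) [fun w => phi (zz_at t w)])%E.

(* Main.v *)
Require Import Defs.
From HB Require Import structures.
From mathcomp Require Import all_boot all_order all_algebra.
From mathcomp Require Import all_classical all_reals all_analysis.
From mathcomp Require Import measurable_realfun.
Import Order.TTheory GRing.Theory Num.Theory.
Import numFieldNormedType.Exports.
Local Open Scope classical_set_scope.
Local Open Scope ring_scope.

(** The zig-zag process moves at speed [a] and, as long as it has not switched,
    it moves with exactly that speed.  Let [phi] be the indicator of the closed
    half-space of positions at least [a].  The process started from [(0, +1)]
    reaches [a] at time [1] when its first waiting time exceeds [1], which has
    the positive probability [survival a lam 1 (0, +1)]
    ([survival_le_semigroup]).  Started from [(y, +1)] with [y < 0], its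
    position at time [1] is at most [y + a < a] ([zigzag_path_le]).  So
    [P(1) phi] vanishes at every [(y, +1)] with [y < 0] ([semigroup_eq0]) but
    is positive at [(0, +1)]: it is not continuous there, although [phi] is
    bounded and Borel.

    The bound on the displacement requires the waiting times to be nonnegative;
    almost surely they are positive, as [survival] is [1] at time [0]. *)

(** The integral of a nonnegative function is a supremum over the simple
    functions below it, so it is monotone even on nonmeasurable functions.
    Expectations along the trajectory can thus be compared with probabilities
    of events on the waiting times, with no study of how measurably
    [num_switches] depends on them. *)
Lemma le_integral_ge0 (R : realType) (d : measure_display)
    (T : measurableType d) (mu : {measure set T -> \bar R})
    (f g : T -> \bar R) :
  (forall x, 0 <= f x)%E -> (forall x, f x <= g x)%E ->
  (\int[mu]_x f x <= \int[mu]_x g x)%E.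
Proof.
move=> f0 fg.
have g0 x : (0 <= g x)%E by exact: le_trans (f0 x) (fg x).
rewrite !ge0_integralTE//; apply: le_ereal_sup => _ [h hf <-].
by exists h => // x; exact: le_trans (hf x) (fg x).
Qed.

Lemma le_expectation_indic (R : realType) (d : measure_display)
    (T : measurableType d) (P : probability T R) (A : set T) (f : T -> R) :
  measurable A -> (forall w, 0 <= f w) -> (forall w, f w <= \1_A w) ->
  ('E_P[f] <= P A)%E.
Proof.
move=> mA f0 fA; rewrite unlock.
have -> : P A = (\int[P]_w (\1_A w)%:E)%E by rewrite integral_indic// setIT.
by apply: le_integral_ge0 => w; rewrite lee_fin.
Qed.

Lemma indic_le_expectation (R : realType) (d : measure_display)
    (T : measurableType d) (P : probability T R) (A : set T) (f : T -> R) :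
  measurable A -> (forall w, \1_A w <= f w) -> (P A <= 'E_P[f])%E.
Proof.
move=> mA fA; rewrite unlock.
have -> : P A = (\int[P]_w (\1_A w)%:E)%E by rewrite integral_indic// setIT.
by apply: le_integral_ge0 => w; rewrite lee_fin// indicE ler0n.
Qed.

Section Path.
Variables (R : realType) (a : R) (a_ge0 : 0 <= a).
Implicit Types (x : state R) (z : nat -> R).

Lemma dir_le1 j : dir j <= 1 :> R.
Proof. by case: j => //=; rewrite lerN10. Qed.

Lemma switch_state_le x z n : (forall k, 0 <= z k) ->
  (switch_state a x z n).1 <= x.1 + a * switch_time z n.
Proof.
move=> z0; elim: n => [|n IH] /=; first by rewrite /switch_time big_ord0 mulr0 addr0.
rewrite /switch_time big_ord_recr /= mulrDr addrA; apply: lerD => //.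
by rewrite ler_wpM2r// ler_piMl// dir_le1.
Qed.

(** If the switching times stay below [t], then [num_switches] is [0], and the
    bound holds because [T_0 = 0]: explosion of the switching times does not
    break the speed bound. *)
Lemma num_switches_le z t : 0 <= t -> switch_time z (num_switches z t) <= t.
Proof.
move=> t0; rewrite /num_switches; case: pselect => [e|_]; last first.
  by rewrite /switch_time big_ord0.
case: ex_minnP => -[|m] _ mmin; first by rewrite /switch_time big_ord0.
by rewrite leNgt; apply/negP => /mmin; rewrite ltnn.
Qed.

Lemma zigzag_path_le x z t : 0 <= t -> (forall k, 0 <= z k) ->
  (zigzag_path a x z t).1 <= x.1 + a * t.
Proof.
move=> t0 z0; rewrite /zigzag_path /=; set n := num_switches z t.
have Tt : 0 <= t - switch_time z n by rewrite subr_ge0 num_switches_le.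
rewrite -[in leRHS](subrKC (switch_time z n) t) [in leRHS]mulrDr addrA.
by rewrite lerD ?switch_state_le// ler_wpM2r// ler_piMl// dir_le1.
Qed.

Lemma zigzag_path_no_switch x z t : t < z 0%N ->
  zigzag_path a x z t = (x.1 + dir x.2 * a * t, x.2).
Proof.
move=> tz; rewrite /zigzag_path.
suff -> : num_switches z t = 0%N by rewrite /= /switch_time big_ord0 subr0.
have t1 : t < switch_time z 1 by rewrite /switch_time big_ord1.
rewrite /num_switches; case: pselect => // e.
by case: ex_minnP => m _ /(_ 0%N t1); rewrite leqn0 => /eqP.
Qed.

End Path.

Section Process.
Variables (R : realType) (a : R) (lam : state R -> R) (x : state R).
Variable X : zigzag_process a lam x.
Local Notation P := (zz_prob X).

Lemma measurable_wait_gt n (t : R) : measurable [set w | t < zz_wait X n w].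
Proof.
rewrite -[X in measurable X]setTI -preimage_itvoy.
by apply: measurable_funP.
Qed.

(** Averaging a conditional law that does not depend on the past gives the
    unconditional law.  This covers the first waiting time, whose past is
    trivial, and the case [t = 0], where the survival probability is [1]. *)
Lemma prob_wait_gt n (t c : R) : 0 <= t ->
  (forall w, survival a lam t (switch_state a x (zz_wait X ^~ w) n) = c) ->
  P [set w | t < zz_wait X n w] = c%:E.
Proof.
move=> t0 Sc; have [_ /(_ setT)] := zz_wait_law X n t0.
have GT : g_sigma_preimage (fun k : 'I_n => zz_wait X k : zz_space X -> R) setT.
  by rewrite -setC0; apply: sigma_algebraC; exact: sigma_algebra0.
move=> /(_ GT); rewrite setIT => ->.
under eq_integral do rewrite Sc.
by rewrite -[RHS]mule1 -(probability_setT P) -integral_cst.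
Qed.

Lemma survival0 (y : state R) : survival a lam 0 y = 1.
Proof.
by rewrite /survival set_itv1 /Rintegral integral_set1 /= oppr0 expR0.
Qed.

Lemma prob_some_wait_le0 :
  measurable (\bigcup_n ~` [set w | 0 < zz_wait X n w]) /\
  P (\bigcup_n ~` [set w | 0 < zz_wait X n w]) = 0%E.
Proof.
have mN n : measurable (~` [set w | 0 < zz_wait X n w]).
  by apply: measurableC; exact: measurable_wait_gt.
have mU : measurable (\bigcup_n ~` [set w | 0 < zz_wait X n w]).
  exact: bigcup_measurable.
split=> //; apply/(negligibleP P mU).
apply: negligible_bigcup => n; apply/(negligibleP P (mN n)).
apply: etrans (probability_setC P (measurable_wait_gt n 0)) _.
rewrite (@prob_wait_gt n 0 1) ?subee// => w; exact: survival0.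
Qed.

End Process.

Definition half_space {R : realType} (b : R) : set (state R) :=
  [set x | b <= x.1].

Lemma half_space_bounded_borel (R : realType) (b : R) :
  bounded_borel (\1_(half_space b) : state R -> R).
Proof.
split; last first.
  exists 1; split=> // M M1 x _ /=.
  by rewrite indicE; case: (_ \in _); rewrite ?normr1 ?normr0 ltW// (lt_trans ltr01).
apply: measurable_indic.
rewrite -[half_space b]setCK; apply: measurableC.
apply: sub_sigma_algebra.
apply/closed_openC.
have -> : half_space b = (fst : (R * bool)%type -> R) @^-1` [set y | b <= y] by [].
apply: closed_comp; last exact: closed_ge.
by move=> x _; exact: cvg_fst.
Qed.

Section Semigroup.
Variables (R : realType) (a : R) (lam : state R -> R).
Variable X : forall x, zigzag_process a lam x.

(** Without a switch up to time [t], the process sits exactly on the boundary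
    [y + a * t] of the half-space. *)
Lemma survival_le_semigroup (y t : R) : 0 <= t ->
  survival a lam t (y, true) <=
    zigzag_semigroup X t (\1_(half_space (y + a * t))) (y, true).
Proof.
move=> t0; set A := half_space _.
pose f := fun w : zz_space (X (y, true)) => \1_A (zz_at t w) : R.
have lb : ((survival a lam t (y, true))%:E <= 'E_(zz_prob (X (y, true)))[f])%E.
  rewrite -(@prob_wait_gt _ _ _ _ (X (y, true)) 0 t (survival a lam t (y, true)) t0)//.
  apply: indic_le_expectation => [|w]; first exact: measurable_wait_gt.
  rewrite /f !indicE; case: (boolP (w \in _)) => [|_]; last by rewrite ler0n.
  rewrite inE /= => tw; suff -> : zz_at t w = (y + a * t, true).
    by rewrite mem_set// /A /half_space /= lexx.
  by rewrite /zz_at zigzag_path_no_switch//= mul1r.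
have ub : ('E_(zz_prob (X (y, true)))[f] <= 1)%E.
  rewrite -(probability_setT (zz_prob (X (y, true)))).
  apply: le_expectation_indic => // w; rewrite /f !indicE ?ler0n//.
  by rewrite in_setT lern1; case: (_ \in _).
rewrite -lee_fin /zigzag_semigroup fineK//.
rewrite ge0_fin_numE; first exact: le_lt_trans ub (ltry _).
by apply: le_trans lb; rewrite lee_fin expR_ge0.
Qed.

(** A position at least [b] would violate the speed bound, so it can occur only
    on the null event that some waiting time is not positive. *)
Lemma semigroup_eq0 (x : state R) (t b : R) :
  0 <= a -> 0 <= t -> x.1 + a * t < b ->
  zigzag_semigroup X t (\1_(half_space b)) x = 0.
Proof.
move=> a0 t0 xb; have [mN PN] := prob_some_wait_le0 _ _ _ _ (X x).
rewrite /zigzag_semigroup; set E := ('E_ _ [_])%E.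
suff -> : E = 0%E by [].
apply/eqP; rewrite eq_le; apply/andP; split; last first.
  by rewrite /E unlock integral_ge0// => w _; rewrite lee_fin indicE ler0n.
rewrite -PN; apply: le_expectation_indic => // w; rewrite !indicE ?ler0n//.
case: (boolP (w \in _)) => [_|wN]; first by rewrite lern1; case: (_ \in _).
rewrite memNset// => /= bw; move/negP: wN; apply.
(* A trajectory that ends beyond [b] has a waiting time that is not positive. *)
rewrite inE; apply: contrapT => wN.
have z0 k : 0 <= zz_wait (X x) k w.
  by apply: ltW; apply: contrapT => kw; apply: wN; exists k.
have := zigzag_path_le _ _ a0 x _ t t0 z0.
by rewrite leNgt (lt_le_trans xb).
Qed.

End Semigroup.

Theorem mainTheorem8 (R : realType) (a : R) (lam : state R -> R)
    (y0 lam_min : R)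
    (a_gt0 : 0 < a)
    (lam_ge0 : forall x, 0 <= lam x)
    (lam_cont : continuous (lam : (R * bool)%type -> R))
    (y0_ge0 : 0 <= y0)
    (lam_min_gt0 : 0 < lam_min)
    (lam_far : forall (y : R) (j : bool), y0 <= dir j * y -> lam_min <= lam (y, j))
    (X : forall x, zigzag_process a lam x) :
  ~ strong_feller (zigzag_semigroup X).
Proof.
move=> /(_ 1 ltr01 _ (half_space_bounded_borel R (0 + a * 1))) [cont _].
set u := zigzag_semigroup X 1 _ in cont.
have u0 : 0 < u (0, true).
  by apply: lt_le_trans (survival_le_semigroup _ _ _ X 0 1 ler01); exact: expR_gt0.
have /= := cvgr_gt _ (cont (0, true)) 0 u0.
move=> [[A B] /= [/nbhs_ballP[e /= e0 eA] Btrue] AB].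
have e2 : 0 < e / 2 by rewrite divr_gt0.
have : 0 < u (- (e / 2), true).
  apply: AB; split=> /=; last exact: nbhs_singleton.
  apply: eA; rewrite /ball /= sub0r opprK gtr0_norm//.
  by rewrite ltr_pdivrMr// ltr_pMr// ltr1n.
by rewrite /u semigroup_eq0 ?ltxx ?ltW//= ltrD2r oppr_lt0.
Qed.
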